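(* Let $A,B,C,\alpha_0,\gamma_0$ be real with $C>0$, let $m\ge1$ be an integer, and let $\beta_0=(m+1)C$. With $w_{n,k}$, $W_n=w_{n,0}$, $a_{n,j}$, $b_{n,j}$ and the generating functions $w,W,a,b$ as in the context, for all $n,j\ge0$ $$a_{n,j}=\mathbf 1_{\{j\ge m\}}\,w_{n,j-m}+mC\sum_{\substack{r,q\ge0\\ r+q=n-1}}W_r\,b_{q,j},$$ the sum being empty when $n=0$. Equivalently, $$a(x,t)=x^m w(x,t)+mC\int_0^t b(x,s)\,W(t-s)\,ds,$$ and thus $$x^m w(x,t)=a(x,t)-mC\int_0^t b(x,s)\,W(t-s)\,ds .$$
   Context: Original model: Motzkin paths start at height $0$, never go below $0$, and have step weights $\alpha_k=Ak+\alpha_0$ for $k\to k+1$, $\gamma_k=Bk+\gamma_0$ for $k\to k$, $\beta_k=Ck+\beta_0=C(k+m+1)$ for $k+1\to k$ ($k\ge0$; down-steps indexed by arrival height). The weight of a path is the product of its step weights (empty path: $1$). $w_{n,k}$ is the total weight of paths of length $n$ ending at height $k$; $W_n=w_{n,0}$; $w(x,t)=\sum_{n,k\ge0}w_{n,k}x^kt^n/n!$; $W(t)=w(0,t)$. Auxiliary shifted model on heights $j\ge0$: step weights $\widetilde\alpha_j=Aj+\alpha_0-mA$ for $j\to j+1$, $\widetilde\gamma_j=Bj+\gamma_0-mB$ for $j\to j$, $\widetilde\beta_j=C(j+1)$ for $j+1\to j$ (these may be zero or negative; totals are then signed). $a_{n,j}$ (respectively $b_{n,j}$) is the total weight of auxiliary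 paths of length $n$ which start at height $m$ (respectively $m-1$), remain at heights $\ge0$, and end at height $j$; $a(x,t)=\sum_{n,j\ge0}a_{n,j}x^jt^n/n!$ and $b(x,t)=\sum_{n,j\ge0}b_{n,j}x^jt^n/n!$. *)

(* Defs.v *)
From HB Require Import structures.
From mathcomp Require Import all_boot all_order all_algebra.
From mathcomp Require Import reals.

Set Implicit Arguments.
Unset Strict Implicit.
Unset Printing Implicit Defensive.

Import Order.TTheory GRing.Theory Num.Theory.
Local Open Scope ring_scope.

Inductive step := Up | Level | Down.

Definition step_code (s : step) : option bool :=
  match s with Up => Some true | Level => None | Down => Some false end.

Definition step_decode (c : option bool) : step :=
  match c with Some true => Up | None => Level | Some false => Down end.

Lemma step_codeK : cancel step_code step_decode. Proof. by case. Qed.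

HB.instance Definition _ := Finite.copy step (can_type step_codeK).

Definition step_to (h : nat) (s : step) : nat :=
  match s with Up => h.+1 | Level => h | Down => h.-1 end.

Definition step_ok (h : nat) (s : step) : bool := (s != Down) || (0 < h)%N.

(* [motzkin h p k]: the path with step word p started at height h stays at
   heights >= 0 and ends at height k. *)
Fixpoint motzkin (h : nat) (p : seq step) (k : nat) : bool :=
  if p is s :: p' then step_ok h s && motzkin (step_to h s) p' k else h == k.

Section Weights.
Variable R : realType.

Definition affine (u v : R) : nat -> R := fun k => u * k%:R + v.

Section Paths.
(* Weights of k -> k+1, of k -> k and of k+1 -> k: down-steps are indexed by
   their arrival height. *)
Variables alpha gamma beta : nat -> R.

Definition step_weight (h : nat) (s : step) : R :=
  match s with Up => alpha h | Level => gamma h | Down => beta h.-1 end.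

Fixpoint path_weight (h : nat) (p : seq step) : R :=
  if p is s :: p' then step_weight h s * path_weight (step_to h s) p' else 1.

(* Total weight of the paths of length n from height i to height k. *)
Definition total_weight (i n k : nat) : R :=
  \sum_(p : n.-tuple step | motzkin i p k) path_weight i p.

(* sum_(n,k) total_weight i n k x^k t^n/n! as an element of R[x][[t]], given by
   its sequence of coefficients of t^n.  The degree bound i + n in x loses
   nothing, see [coef_path_egf]. *)
Definition path_egf (i n : nat) : {poly R} :=
  n`!%:R^-1 *: \poly_(k < (i + n).+1) total_weight i n k.

Lemma motzkin_bound i p k : motzkin i p k -> (k <= i + size p)%N.
Proof.
elim: p i => [|s p IHp] i /=; first by move=> /eqP <-; rewrite addn0.
case/andP=> _ /IHp le_k; apply: leq_trans le_k _.
rewrite addnS -addSn leq_add2r; case: s => //=.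
by apply: leq_trans (leq_pred i) _.
Qed.

Lemma coef_path_egf i n k : (path_egf i n)`_k = total_weight i n k / n`!%:R.
Proof.
rewrite coefZ coef_poly mulrC; case: ltnP => // lt_k; congr (_ * _).
rewrite /total_weight big1 // => p /motzkin_bound; rewrite size_tuple => le_k.
by have:= leq_trans lt_k le_k; rewrite ltnn.
Qed.

End Paths.

(* Formal power series in s and t over R[x]: F i j is the coefficient of
   s^i t^j. *)
Definition series2 := nat -> nat -> {poly R}.

Definition mul_series2 (F G : series2) : series2 := fun i j =>
  \sum_(p < i.+1) \sum_(q < j.+1) F p q * G (i - p)%N (j - q)%N.

(* f(s) *)
Definition series_s (f : nat -> {poly R}) : series2 := fun i j =>
  if j == 0%N then f i else 0.

(* f(t - s) = sum_n f_n (t - s)^n, expanded by the binomial theorem. *)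
Definition series_t_sub_s (f : nat -> {poly R}) : series2 := fun i j =>
  ((-1) ^+ i * 'C(i + j, i)%:R) *: f (i + j)%N.

(* The antiderivative in s that vanishes at s = 0. *)
Definition primitive_s (F : series2) : series2 := fun i j =>
  if i is i'.+1 then i%:R^-1 *: F i' j else 0.

Definition eval_s_at_t (F : series2) : nat -> {poly R} := fun n =>
  \sum_(i < n.+1) F i (n - i)%N.

(* int_0^t F(s,t) ds *)
Definition integral_0_t (F : series2) : nat -> {poly R} :=
  eval_s_at_t (primitive_s F).

End Weights.

(* Main.v *)
Require Import Defs.
From mathcomp Require Import all_boot all_order all_algebra.
From mathcomp Require Import reals.
From mathcomp Require Import ring zify.

Set Implicit Arguments.
Unset Strict Implicit.
Unset Printing Implicit Defensive.

Import Order.TTheory GRing.Theory Num.Theory.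
Local Open Scope ring_scope.

(** The coefficient identity is a first-passage decomposition.  Moving the
    original model up by [m] turns its step weights into the auxiliary ones:
    this is what the terms [- m%:R * A], [- m%:R * B] and the value of [beta0]
    achieve.  Hence an auxiliary path started at height [m] either never goes
    below [m], and is then a translated original path, or it has a first step
    from [m] to [m.-1].  That step has weight [C * m]; the part before it is a
    translated original path returning to height 0, counted by [W], and the
    part after it is an arbitrary auxiliary path started at [m.-1], counted by
    [b].  In [total_weight_first_passage] this is proved for every starting
    height [m + h] by induction on the length, since conditioning on the first
    step ([total_weightS]) then reduces the claim to shorter paths on both
    sides.

    For the generating functions, the integral of [f(s) g(t - s)] from 0 to
    [t] pairs the monomials [s^p] and [(t - s)^q] into the Beta integral
    [p! q! / (p + q + 1)! t^(p + q + 1)], so that it is the ordinary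
    convolution of the sequences that [f] and [g] generate exponentially.  As
    the product is expanded here by the binomial theorem, the Beta integral
    shows up as an alternating sum, evaluated in [sum_alternating_bin_inv]. *)

Section FirstStep.
Variable R : realType.

Lemma big_step (F : step -> R) : \sum_s F s = F Up + F Level + F Down.
Proof.
rewrite (bigD1 Up) //= (bigD1 Level) //= (big_pred1 Down) ?addrA //.
by case.
Qed.

Lemma big_cons_tuple (T : finType) n (P : pred (seq T)) (F : seq T -> R) :
  \sum_(p : n.+1.-tuple T | P p) F p =
  \sum_s \sum_(p : n.-tuple T | P (s :: p)) F (s :: p).
Proof.
rewrite pair_big_dep /=.
rewrite (reindex (fun q : T * n.-tuple T => [tuple of q.1 :: q.2])) //=.
exists (fun p : n.+1.-tuple T => (thead p, [tuple of behead p])).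
  by move=> [s p] _; congr pair; apply/val_inj.
by move=> p _; rewrite /= -tuple_eta.
Qed.

Section Recurrence.
Variables alpha gamma beta : nat -> R.
Local Notation T := (total_weight alpha gamma beta).

Lemma total_weight0 i k : T i 0 k = (i == k)%:R.
Proof.
rewrite /total_weight big_mkcond (big_pred1 [tuple]) /=; last first.
  by move=> p; apply/esym/eqP; apply: tuple0.
by case: (i == k).
Qed.

Lemma total_weightS i n k :
  T i n.+1 k = alpha i * T i.+1 n k + gamma i * T i n k
               + (if i is i'.+1 then beta i' * T i' n k else 0).
Proof.
rewrite /total_weight.
rewrite (big_cons_tuple n (fun p => motzkin i p k) (path_weight alpha gamma beta i)).
rewrite big_step /= -!big_distrr /=; congr (_ + _).
case: i => [|i] /=; first by rewrite big_pred0 ?mulr0.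
by [].
Qed.

End Recurrence.

(** The shift by [m.+1] is a hypothesis on arbitrary weights: the path argument
    does not see how the weights depend on the height.  Starting at [m.+1 + h]
    rather than at [m.+1] is what makes the induction on [n] go through. *)
Lemma total_weight_first_passage (alpha gamma beta alpha' gamma' beta' : nat -> R)
    (m : nat) :
  (forall k, alpha' (m.+1 + k)%N = alpha k) ->
  (forall k, gamma' (m.+1 + k)%N = gamma k) ->
  (forall k, beta' (m.+1 + k)%N = beta k) ->
  forall n h j,
  total_weight alpha' gamma' beta' (m.+1 + h) n j =
    (if (m.+1 <= j)%N then total_weight alpha gamma beta h n (j - m.+1) else 0)
    + beta' m * \sum_(r < n) total_weight alpha gamma beta h r 0
                             * total_weight alpha' gamma' beta' m (n - r.+1) j.
Proof.
move=> eq_alpha eq_gamma eq_beta; elim=> [|n IHn] h j.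
  rewrite big_ord0 mulr0 addr0 !total_weight0.
  case: ltnP => [lt_mj|le_jm].
    by rewrite -[X in _ == X](subnKC lt_mj) eqn_add2l.
  by rewrite gtn_eqF // addSn ltnS (leq_trans le_jm) // leq_addr.
have IHS := IHn h.+1 j; rewrite addnS in IHS.
rewrite total_weightS eq_alpha eq_gamma IHS IHn.
rewrite big_ord_recl total_weight0 subn1 /=.
under [X in _ = _ + _ * (_ + X)]eq_bigr => r _ do
  rewrite /bump leq0n add1n subSS total_weightS !mulrDl -!mulrA.
rewrite !big_split /= -!mulr_sumr total_weightS.
case: h IHS => [|h] _.
  (* At height [m.+1] a down-step is the first passage, i.e. the term r = 0. *)
  rewrite addn0 eqxx.
  under [X in _ = _ + _ * (_ + (_ + X))]eq_bigr => r _ do rewrite mul0r.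
  by rewrite big1_eq; case: ltnP => _ /=; ring.
rewrite -addSnnS eq_beta IHn.
under [X in _ = _ + _ * (_ + (_ + X))]eq_bigr => r _ do rewrite -mulrA.
by rewrite -mulr_sumr; case: ltnP => _ /=; ring.
Qed.

End FirstStep.

Section Convolution.
Variable R : realType.

(** This is the Beta integral of [s ^ p * (1 - s) ^ q] over [[0, 1]], expanded
    in powers of [s].  The induction on [q] writes one factor [1 - s] as a
    difference, which on the left-hand side is Pascal's rule. *)
Lemma sum_alternating_bin_inv p q :
  \sum_(l < q.+1) (-1) ^+ l * 'C(q, l)%:R / (p + l).+1%:R
    = p`!%:R * q`!%:R / (p + q).+1`!%:R :> R.
Proof.
have nzS k : k.+1%:R != 0 :> R by rewrite pnatr_eq0.
have nzF k : k`!%:R != 0 :> R by rewrite pnatr_eq0 -lt0n fact_gt0.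
elim: q p => [|q IHq] p.
  rewrite big_ord1 /= !addn0 expr0 bin0 factS natrM fact0; field.
  by rewrite nzF addrC natr1 nzS.
have -> : \sum_(l < q.+2) (-1) ^+ l * 'C(q.+1, l)%:R / (p + l).+1%:R
        = \sum_(l < q.+1) (-1) ^+ l * 'C(q, l)%:R / (p + l).+1%:R
          - \sum_(l < q.+1) (-1) ^+ l * 'C(q, l)%:R / (p.+1 + l).+1%:R :> R.
  rewrite big_ord_recl [X in _ = X - _]big_ord_recl /= !bin0 -addrA; congr (_ + _).
  under eq_bigr => l _ do
    rewrite /bump leq0n add1n binS natrD mulrDr mulrDl.
  rewrite big_split /=; congr (_ + _).
    by rewrite big_ord_recr /= bin_small // mulr0 mul0r addr0.
  rewrite -sumrN; apply: eq_bigr => l _.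
  by rewrite exprS addnS addSn mulN1r !mulNr.
rewrite !IHq !addSn !addnS !factS !natrM.
have -> : (p + q).+2%:R = p.+1%:R + q.+1%:R :> R by rewrite -natrD addSn addnS.
field.
by rewrite nzF -!natrD !nat1r -natrD !nzS.
Qed.

(** In the integral, [i] is the exponent of [s] in a term of the expanded
    product, [p] the part of it due to [f(s)] and [l = i - p] the part due to
    the power of [t - s].  Exchanging the sums fixes [p], which leaves the
    alternating sum over [l]. *)
Lemma big_triangle (V : nmodType) n (G : nat -> nat -> V) :
  \sum_(i < n) \sum_(p < i.+1) G p (i - p)%N = \sum_(p < n) \sum_(l < n - p) G p l.
Proof.
elim: n => [|n IHn]; first by rewrite !big_ord0.
rewrite big_ord_recr /= IHn.
under [RHS]eq_bigr => p _ do rewrite subSn ?leq_ord // big_ord_recr /=.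
rewrite [RHS]big_split /=; congr (_ + _).
by rewrite big_ord_recr /= subnn big_ord0 addr0.
Qed.

Lemma coef_mul_series_s_t_sub_s (f g : nat -> {poly R}) i j :
  mul_series2 (series_s f) (series_t_sub_s g) i j =
  \sum_(p < i.+1) ((-1) ^+ (i - p) * 'C(i - p + j, i - p)%:R)
                  *: (f p * g (i - p + j)%N).
Proof.
apply: eq_bigr => p _; rewrite big_ord_recl subn0 big1 ?addr0 => [|q _].
  by rewrite /series_s /series_t_sub_s eqxx scalerAr.
by rewrite /series_s /= mul0r.
Qed.

Lemma integral_0_t_convolution (f g : nat -> {poly R}) n :
  integral_0_t (mul_series2 (series_s f) (series_t_sub_s g)) n =
  \sum_(p < n) (p`!%:R * (n - p.+1)`!%:R / n`!%:R) *: (f p * g (n - p.+1)%N).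
Proof.
rewrite /integral_0_t /eval_s_at_t big_ord_recl add0r.
pose G p l := ((-1) ^+ l * 'C(n - p.+1, l)%:R / (p + l).+1%:R)
                *: (f p * g (n - p.+1)%N).
transitivity (\sum_(i < n) \sum_(p < i.+1) G p (i - p)%N).
  apply: eq_bigr => i _; rewrite lift0 /= coef_mul_series_s_t_sub_s scaler_sumr.
  apply: eq_bigr => p _; have le_pi : (p <= i)%N by rewrite -ltnS.
  have eq_q : (i - p + (n - i.+1) = n - p.+1)%N.
    by have := ltn_ord i; lia.
  by rewrite /G eq_q subnKC // scalerA mulrC.
rewrite big_triangle; apply: eq_bigr => p _; rewrite -scaler_suml; congr (_ *: _).
have := sum_alternating_bin_inv p (n - p.+1).
by rewrite -subSn // subSS -addnS -subSn // subSS subnKC // ltnW.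
Qed.

End Convolution.

Theorem proposition3p1 (R : realType) (A B C alpha0 gamma0 beta0 : R) (m : nat)
    (hC : 0 < C) (hm : (1 <= m)%N) (hbeta0 : beta0 = m.+1%:R * C) :
  let alpha := affine A alpha0 in
  let gamma := affine B gamma0 in
  let beta := affine C beta0 in
  let alpha' := fun j : nat => A * j%:R + alpha0 - m%:R * A in
  let gamma' := fun j : nat => B * j%:R + gamma0 - m%:R * B in
  let beta' := fun j : nat => C * j.+1%:R in
  let w := total_weight alpha gamma beta 0 in
  let W := fun n : nat => w n 0%N in
  let a := total_weight alpha' gamma' beta' m in
  let b := total_weight alpha' gamma' beta' m.-1 in
  let w_xt := path_egf alpha gamma beta 0 in
  let W_t := fun n : nat => (w_xt n).[0]%:P in
  let a_xt := path_egf alpha' gamma' beta' m in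
  let b_xt := path_egf alpha' gamma' beta' m.-1 in
  let I := integral_0_t (mul_series2 (series_s b_xt) (series_t_sub_s W_t)) in
  [/\ forall n j : nat,
        a n j = (if (m <= j)%N then w n (j - m)%N else 0)
                + m%:R * C * \sum_(r < n) W r * b (n - r.+1)%N j,
      forall n : nat, a_xt n = 'X^m * w_xt n + (m%:R * C) *: I n
    & forall n : nat, 'X^m * w_xt n = a_xt n - (m%:R * C) *: I n].
Proof.
move=> alpha gamma beta alpha' gamma' beta' w W a b w_xt W_t a_xt b_xt I.
have coef_a n j : a n j = (if (m <= j)%N then w n (j - m)%N else 0)
                + m%:R * C * \sum_(r < n) W r * b (n - r.+1)%N j.
  case: m hm hbeta0 @alpha' @gamma' @beta' @a @b @a_xt @b_xt @I
    => // m' _ hbeta alpha' gamma' beta' a b _ _ _.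
  have := @total_weight_first_passage R alpha gamma beta alpha' gamma' beta' m'.
  move=> passage; have := passage _ _ _ n 0%N j; rewrite addn0 [m'.+1%:R * C]mulrC.
  by apply=> k; rewrite /alpha' /gamma' /beta' /alpha /gamma /beta /affine ?hbeta
    -?addnS ?natrD; ring.
have egf_a n : a_xt n = 'X^m * w_xt n + (m%:R * C) *: I n.
  have nzF k : k`!%:R != 0 :> R by rewrite pnatr_eq0 -lt0n fact_gt0.
  apply/polyP => j.
  rewrite coefD coefXnM (coefZ (_ * C)) /I integral_0_t_convolution coef_sum.
  rewrite !coef_path_egf -/a -/w coef_a mulrDl; congr (_ + _).
    by rewrite ltnNge; case: leqP => _; rewrite ?mul0r.
  rewrite -mulrA; congr (_ * _).
  (* [r] is the length of the part before the first passage, whereas the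
     convolution is indexed by the length of the part after it. *)
  rewrite (reindex_inj rev_ord_inj) mulr_suml /=; apply: eq_bigr => p _.
  rewrite coefZ coefMC horner_coef0 !coef_path_egf.
  rewrite -subSn // subSS (subKn (ltnW _)) // /W /w /b; field.
  by rewrite !nzF.
by split=> // n; rewrite egf_a addrK.
Qed.
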